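(* Let $\mathcal{M}$ be a matroid and let $e,e'$ be distinct parallel elements of $\mathcal{M}$. Then \[ \mathrm{Dr}(\mathcal{M})/\mathrm{lin}\,\mathrm{Dr}(\mathcal{M})\;\cong\;\mathrm{Dr}(\mathcal{M}\setminus e')/\mathrm{lin}\,\mathrm{Dr}(\mathcal{M}\setminus e'), \] and $\dim\mathrm{lin}\,\mathrm{Dr}(\mathcal{M})=\dim\mathrm{lin}\,\mathrm{Dr}(\mathcal{M}\setminus e')+1$.
   Context: Two elements $e,e'$ are parallel if $\mathrm{rank}(\{e,e'\})=1$. The deletion $\mathcal{M}\setminus e'$ is the matroid on $E\setminus\{e'\}$ whose bases are the bases of $\mathcal{M}$ not containing $e'$. For a matroid $\mathcal{M}$ of rank $d$ with bases $\mathcal{B}$, the local Dressian $\mathrm{Dr}(\mathcal{M})\subseteq\mathbb{R}^{\mathcal{B}}/\mathbb{R}\mathbf{1}$ is the set of $w$ such that, with $w_A=\infty$ for non-bases $A$, for every $(d-2)$-set $S$ and distinct $i,j,k,l\notin S$ the minimum of $w_{S\cup ij}+w_{S\cup kl},\ w_{S\cup ik}+w_{S\cup jl},\ w_{S\cup il}+w_{S\cup jk}$ is attained at least twice (or all are $\infty$). $\mathrm{lin}\,\mathrm{Dr}(\mathcal{M})$ denotes its lineality space, the largest linear subspace contained in every cone of this fan.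
   Formalization: Parallel elements are additionally required to be non-loops (rank({e}) = rank({e'}) = 1), since with rank({e,e'}) = 1 alone a loop would be parallel to every non-loop and the claim would fail. *)

(* Defs.v *)
From HB Require Import structures.
From mathcomp Require Import all_boot all_order all_algebra.
From mathcomp Require Import boolp classical_sets reals constructive_ereal.

Set Implicit Arguments.
Unset Strict Implicit.
Unset Printing Implicit Defensive.

Import Order.TTheory GRing.Theory Num.Theory.

Local Open Scope classical_set_scope.
Local Open Scope ring_scope.

Record matroid (T : finType) := Matroid {
  ground : {set T};
  bases : {set {set T}};
  bases_sub_ground : forall B, B \in bases -> B \subset ground;
  bases_neq0 : exists B, B \in bases;
  bases_exchange : forall B1 B2 x, B1 \in bases -> B2 \in bases ->
    x \in B1 :\: B2 ->
    exists2 y, y \in B2 :\: B1 & (y |: B1 :\ x)%SET \in bases }.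

Definition rank (T : finType) (M : matroid T) (A : {set T}) : nat :=
  \max_(B in bases M) #|A :&: B|.

(* The clauses on singletons say that neither element is a loop; parallelism is
   a relation between non-loops, and rank {e, e'} = 1 alone would relate every
   loop to every non-loop. *)
Definition parallel (T : finType) (M : matroid T) (e e' : T) : Prop :=
  [/\ rank M [set e]%SET = 1%N, rank M [set e']%SET = 1%N
    & rank M [set e; e']%SET = 1%N].

Definition avoidable (T : finType) (M : matroid T) (e : T) : Prop :=
  exists2 B, B \in bases M & e \notin B.

Definition deletion_bases (T : finType) (M : matroid T) (e : T) :
  {set {set T}} := [set B in bases M | e \notin B]%SET.

Lemma deletion_sub_ground (T : finType) (M : matroid T) (e : T) B :
  B \in deletion_bases M e -> B \subset (ground M :\ e)%SET.
Proof. by rewrite inE subsetD1 => /andP[/bases_sub_ground -> ->]. Qed.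

Lemma deletion_neq0 (T : finType) (M : matroid T) (e : T) :
  avoidable M e -> exists B, B \in deletion_bases M e.
Proof. by move=> [B Bb eB]; exists B; rewrite inE Bb. Qed.

Lemma deletion_exchange (T : finType) (M : matroid T) (e : T) B1 B2 x :
  B1 \in deletion_bases M e -> B2 \in deletion_bases M e ->
  x \in B1 :\: B2 ->
  exists2 y, y \in B2 :\: B1 & (y |: B1 :\ x)%SET \in deletion_bases M e.
Proof.
rewrite !inE => /andP[b1 e1] /andP[b2 e2] xB.
have [|y yB bb] := bases_exchange (x := x) b1 b2; first by rewrite inE.
exists y => //; rewrite inE bb /=; move: yB; rewrite !inE => /andP[_ y2].
by rewrite negb_or negb_and e1 orbT andbT; apply: contraNneq e2 => ->.
Qed.

Definition deletion (T : finType) (M : matroid T) (e : T)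
    (he : avoidable M e) : matroid T :=
  Matroid (@deletion_sub_ground T M e) (deletion_neq0 he)
    (@deletion_exchange T M e).

Lemma parallel_avoidable (T : finType) (M : matroid T) (e e' : T) :
  e != e' -> parallel M e e' -> avoidable M e'.
Proof.
move=> ee' [re _ ree'].
have [B Bb eB] : exists2 B, B \in bases M & e \in B.
  apply: contrapT => noB; suff: rank M [set e]%SET = 0%N by rewrite re.
  apply: big1 => B Bb; apply/eqP; rewrite cards_eq0 -finset.subset0.
  apply/fintype.subsetP => x; rewrite !inE => /andP[/eqP -> eB].
  by case: noB; exists B.
exists B => //; apply/negP => e'B.
have : (#|[set e; e']%SET :&: B| <= rank M [set e; e']%SET)%N.
  exact: (@leq_bigmax_cond _ (mem (bases M))
    (fun B : {set T} => #|[set e; e'] :&: B|)).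
have /finset.setIidPl -> : [set e; e']%SET \subset B.
  by apply/fintype.subsetP => x; rewrite !inE => /orP[] /eqP ->.
by rewrite ree' cards2 ee'.
Qed.

(* V / U, carried by the complement U^C of U; the projection quot_pi U is
   surjective with kernel U (quot_pi_surj, lker_quot_pi). *)
Definition quotv (K : fieldType) (V : vectType K) (U : {vspace V}) : Type :=
  subvs_of (U^C)%VS.

HB.instance Definition _ (K : fieldType) (V : vectType K) (U : {vspace V}) :=
  Vector.on (quotv U).

Definition quot_pi (K : fieldType) (V : vectType K) (U : {vspace V}) :
    'Hom(V, quotv U) :=
  linfun (vsproj (U^C)%VS \o daddv_pi (U^C)%VS U).

Lemma quot_pi_surj (K : fieldType) (V : vectType K) (U : {vspace V})
  (x : quotv U) : exists v, quot_pi U v = x.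
Proof.
exists (vsval (x : subvs_of _)); rewrite lfunE /= daddv_pi_id ?subvsP ?vsvalK //.
by rewrite capvC capv_compl.
Qed.

Lemma lker_quot_pi (K : fieldType) (V : vectType K) (U : {vspace V}) :
  lker (quot_pi U) = U.
Proof.
have dUC : (U^C :&: U = 0)%VS by rewrite capvC capv_compl.
have full v : v \in (U^C + U)%VS by rewrite addvC addv_complf memvf.
apply/vspaceP => v; rewrite memv_ker lfunE /=.
rewrite -{2}(daddv_pi_add dUC (full v)).
apply/eqP/idP => [/(congr1 vsval)|h].
  by rewrite vsprojK ?memv_pi // linear0 => ->; rewrite add0r memv_pi.
have : daddv_pi (U^C)%VS U v \in (U^C :&: U)%VS.
  rewrite memv_cap memv_pi /= -(addrK (daddv_pi U (U^C)%VS v) (daddv_pi _ _ v)).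
  by rewrite rpredB // memv_pi.
by rewrite dUC memv0 => /eqP ->; rewrite linear0.
Qed.

Definition is_lineality (K : fieldType) (V : vectType K) (F : set (set V))
    (L : {vspace V}) : Prop :=
  (forall C, F C -> [set` L] `<=` C) /\
  (forall L' : {vspace V}, (forall C, F C -> [set` L'] `<=` C) -> (L' <= L)%VS).

(* The default 0 is never used for local Dressians: see dr_linP. *)
Definition lineality (K : fieldType) (V : vectType K) (F : set (set V)) :
    {vspace V} := xget 0%VS [set L | is_lineality F L].

Lemma linealityP (K : fieldType) (V : vectType K) (F : set (set V)) :
  (forall C, F C -> C 0) ->
  (forall C x y, F C -> C x -> C y -> C (x + y)) ->
  is_lineality F (lineality F).
Proof.
move=> F0 FD; pose P (U : {vspace V}) := forall C, F C -> [set` U] `<=` C.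
suff [L HL] : exists L, is_lineality F L by apply: (xgetPex 0%VS); exists L.
pose p n := `[< exists2 U, P U & \dim U = n >].
have p0 : exists n, p n.
  exists 0%N; apply/asboolP; exists 0%VS; last by rewrite dimv0.
  by move=> C FC x /=; rewrite memv0 => /eqP ->; apply: F0.
have pb n : p n -> (n <= \dim {:V})%N.
  by move=> /asboolP[U _ <-]; rewrite dimvS // subvf.
have [n /asboolP[L PL <-] maxL] := ex_maxnP p0 pb.
exists L; split => // L' PL'.
have PLL' : P (L + L')%VS.
  move=> C FC _ /memv_addP[u uL [v vL' ->]].
  by apply: FD => //; [apply: PL|apply: PL'].
have /maxL dLL' : p (\dim (L + L')) by apply/asboolP; exists (L + L')%VS.
by rewrite (eqP (_ : L == L + L')%VS) ?addvSr // eqEdim addvSl.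
Qed.

Definition in_span (K : fieldType) (V : vectType K) (X : set V) (v : V) : Prop :=
  forall U : {vspace V}, X `<=` [set` U] -> v \in U.

(* Isomorphism of a fan F with support X onto a fan G with support Y: a linear
   isomorphism from the span of X onto the span of Y that carries X onto Y and
   the cones of F onto the cones of G. The ambient spaces may have different
   dimensions. *)
Definition fan_isomorphic (K : fieldType) (V W : vectType K)
    (X : set V) (F : set (set V)) (Y : set W) (G : set (set W)) : Prop :=
  exists f : 'Hom(V, W),
    [/\ forall x y, in_span X x -> in_span X y -> f x = f y -> x = y,
        f @` X = Y
      & [set f @` C | C in F] = G].

Definition basis (T : finType) (M : matroid T) : finType :=
  {B : {set T} | B \in bases M}.

Definition weights (R : realType) (T : finType) (M : matroid T) : vectType R :=
  {ffun basis M -> R^o}.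

Definition ones (R : realType) (T : finType) (M : matroid T) : weights R M :=
  [ffun=> 1].

Definition weights_mod (R : realType) (T : finType) (M : matroid T) :
    vectType R := quotv <[ones R M]>%VS.

Definition wext (R : realType) (T : finType) (M : matroid T) (w : weights R M)
    (A : {set T}) : \bar R :=
  if (insub A : option (basis M)) is Some B then (w B)%:E else +oo%E.

(* A (d-2)-set S and distinct i, j, k, l outside S, where d is the rank of M;
   there are none if d < 2. *)
Record plucker_index (T : finType) (M : matroid T) := PluckerIndex {
  idx_S : {set T};
  idx_i : T;
  idx_j : T;
  idx_k : T;
  idx_l : T;
  idx_S_sub : idx_S \subset ground M;
  idx_S_card : (#|idx_S| + 2 = rank M (ground M))%N;
  idx_uniq : uniq [:: idx_i; idx_j; idx_k; idx_l];
  idx_mem : {subset [:: idx_i; idx_j; idx_k; idx_l] <= ground M :\: idx_S} }.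

Definition plucker_term (R : realType) (T : finType) (M : matroid T)
    (w : weights R M) (q : plucker_index M) (t : 'I_3) : \bar R :=
  let i := idx_i q in let j := idx_j q in
  let k := idx_k q in let l := idx_l q in
  let W a b := wext w (idx_S q :|: [set a; b])%SET in
  tnth [tuple (W i j + W k l)%E; (W i k + W j l)%E; (W i l + W j k)%E] t.

Definition attains_min (R : realType) (T : finType) (M : matroid T)
    (w : weights R M) (q : plucker_index M) (t : 'I_3) : Prop :=
  forall t', (plucker_term w q t <= plucker_term w q t')%E.

(* If all three terms are +oo the condition holds. *)
Definition valuated (R : realType) (T : finType) (M : matroid T)
    (w : weights R M) : Prop :=
  forall q : plucker_index M,
    exists t1 t2, [/\ t1 != t2, attains_min w q t1 & attains_min w q t2].

Definition dr (R : realType) (T : finType) (M : matroid T) :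
    set (weights_mod R M) :=
  [set quot_pi <[ones R M]>%VS w | w in [set w | valuated w]].

Arguments dr R {T} M _.

(* The closed cone having w in its relative interior: it is the closure of the
   set of w' for which, in each three-term relation, the minimum is attained at
   exactly the same terms as for w. *)
Definition plucker_cone (R : realType) (T : finType) (M : matroid T)
    (w : weights R M) : set (weights R M) :=
  [set w' | forall q t, attains_min w q t -> attains_min w' q t].

Definition dr_fan (R : realType) (T : finType) (M : matroid T) :
    set (set (weights_mod R M)) :=
  [set quot_pi <[ones R M]>%VS @` plucker_cone w | w in [set w | valuated w]].

Arguments dr_fan R {T} M _.

Definition dr_lin (R : realType) (T : finType) (M : matroid T) :
    {vspace weights_mod R M} := lineality (dr_fan R M).

Definition dr_mod_lin (R : realType) (T : finType) (M : matroid T) :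
    set (quotv (dr_lin R M)) := quot_pi (dr_lin R M) @` dr R M.

Arguments dr_mod_lin R {T} M _.

Definition dr_fan_mod_lin (R : realType) (T : finType) (M : matroid T) :
    set (set (quotv (dr_lin R M))) :=
  [set quot_pi (dr_lin R M) @` C | C in dr_fan R M].

Arguments dr_fan_mod_lin R {T} M _.

Lemma dr_fan_support (R : realType) (T : finType) (M : matroid T) :
  \bigcup_(C in dr_fan R M) C = dr R M.
Proof.
apply/seteqP; split=> x.
  move=> [_ [w /= vw <-]] [w' ww' <-]; exists w' => //= q.
  by have [t1 [t2 [? /ww' ? /ww' ?]]] := vw q; exists t1, t2.
move=> [w /= vw <-]; exists (quot_pi <[ones R M]>%VS @` plucker_cone w).
  by exists w.
by exists w.
Qed.

Lemma wextD (R : realType) (T : finType) (M : matroid T) (w1 w2 : weights R M)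
  (A : {set T}) : wext (w1 + w2) A = (wext w1 A + wext w2 A)%E.
Proof. by rewrite /wext; case: insub => [B|//]; rewrite ffunE EFinD. Qed.

Lemma plucker_termD (R : realType) (T : finType) (M : matroid T)
  (w1 w2 : weights R M) (q : plucker_index M) (t : 'I_3) :
  plucker_term (w1 + w2) q t = (plucker_term w1 q t + plucker_term w2 q t)%E.
Proof.
by case: t => [[|[|[|//]]] ?]; rewrite /plucker_term !(tnth_nth 0%E) /= !wextD
  addeACA.
Qed.

Lemma plucker_term0 (R : realType) (T : finType) (M : matroid T)
  (w : weights R M) (q : plucker_index M) (t : 'I_3) :
  plucker_term (0 : weights R M) q t =
    (if plucker_term w q t == +oo%E then +oo%E else 0%E : \bar R).
Proof.
by case: t => [[|[|[|//]]] ?]; rewrite /plucker_term !(tnth_nth 0%E) /= /wext;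
  do 2 case: insub => [?|//]; rewrite ?ffunE ?adde0.
Qed.

Lemma plucker_cone0 (R : realType) (T : finType) (M : matroid T)
  (w : weights R M) : plucker_cone w 0.
Proof.
move=> q t mt t'; rewrite !(plucker_term0 w); have := mt t'.
by have [->|_] := eqVneq (plucker_term w q t) +oo%E;
  have [->|h] := eqVneq (plucker_term w q t') +oo%E;
  rewrite ?leey // leye_eq (negPf h).
Qed.

Lemma plucker_coneD (R : realType) (T : finType) (M : matroid T)
  (w w1 w2 : weights R M) :
  plucker_cone w w1 -> plucker_cone w w2 -> plucker_cone w (w1 + w2).
Proof.
move=> c1 c2 q t mt t'; rewrite !plucker_termD.
by apply: leeD; [apply: c1|apply: c2].
Qed.

Lemma dr_linP (R : realType) (T : finType) (M : matroid T) :
  is_lineality (dr_fan R M) (dr_lin R M).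
Proof.
apply: linealityP => [_ [w _ <-]|_ x y [w _ <-] [w1 c1 <-] [w2 c2 <-]].
  by exists 0; [exact: plucker_cone0|rewrite linear0].
by exists (w1 + w2); [exact: plucker_coneD|rewrite linearD].
Qed.

(* Main.v *)
(* Write N for the deletion of e'. Bases of M never contain both e and e', and
   exchanging e' for e maps bases of M containing e' to bases of N. In the
   three-term relation at S, e, e', k, l the term containing S+ee' is infinite,
   so the other two agree: w(S+e'k) - w(S+ek) = w(S+e'l) - w(S+el). As the bases
   containing e' are connected under exchange, a valuation w of M satisfies
   w(A+e') = w(A+e) + c for one constant c, hence is the pair of its restriction
   to N and c. Under this correspondence every other relation of M is, up to
   adding the same real to its three terms, a relation of N or is infinite, so
   the cones of M are those of N times the line of c, which lies in the
   lineality space. *)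
Require Import Defs.
From HB Require Import structures.
From mathcomp Require Import all_boot all_order all_algebra fingroup perm.
From mathcomp Require Import boolp classical_sets reals constructive_ereal.

Set Implicit Arguments.
Unset Strict Implicit.
Unset Printing Implicit Defensive.

Import Order.TTheory GRing.Theory Num.Theory.

Local Open Scope ring_scope.

(** * Bases of a matroid: cardinality, augmentation, three-term exchange *)

Section MatroidBases.
Variables (T : finType) (M : matroid T).
Implicit Types A B I : {set T}.

Lemma card_exchange B x y : x \in B -> y \notin B -> #|y |: B :\ x| = #|B|.
Proof.
by move=> xB yB; rewrite cardsU1 !inE (negPf yB) andbF (cardsD1 x B) xB.
Qed.

(** The measure that decreases in every induction along exchanges toward [B2]: [x] leaves the
    difference and [y] does not enter it. *)
Lemma exchange_setD_proper B1 B2 x y : x \in B1 :\: B2 -> y \in B2 ->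
  (#|(y |: B1 :\ x) :\: B2| < #|B1 :\: B2|)%N.
Proof.
move=> xB yB; apply: proper_card; apply/properP; split.
  apply/fintype.subsetP => z; rewrite !inE => /andP[zB2].
  by case/orP => [/eqP zy|/andP[_ ->]]; [rewrite zy yB in zB2|rewrite zB2].
by exists x => //; move: xB; rewrite !inE eqxx => /andP[xB2 _];
  case: eqP => [xy|]; [rewrite xy yB in xB2|rewrite andbF].
Qed.

(** Exchanges keep the cardinality and bring [B1] closer to [B2], until [B1] is contained in
    [B2]. *)
Lemma leq_card_bases B1 B2 : B1 \in bases M -> B2 \in bases M ->
  (#|B1| <= #|B2|)%N.
Proof.
have [n] := ubnP #|B1 :\: B2|; elim: n B1 => // n IH B1 ltn b1 b2.
have [/eqP|[x xB]] := set_0Vmem (B1 :\: B2).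
  by rewrite finset.setD_eq0 => /subset_leq_card.
have [y yB b] := bases_exchange b1 b2 xB.
move: (xB) (yB); rewrite !inE => /andP[_ xB1] /andP[yB1 yB2].
rewrite -(card_exchange xB1 yB1); apply: IH => //.
exact: leq_trans (exchange_setD_proper xB yB2) _.
Qed.

Lemma card_bases B1 B2 : B1 \in bases M -> B2 \in bases M -> #|B1| = #|B2|.
Proof. by move=> b1 b2; apply/eqP; rewrite eqn_leq !leq_card_bases. Qed.

Lemma rank_ground B : B \in bases M -> rank M (ground M) = #|B|.
Proof.
move=> bB; have cI B' : B' \in bases M -> #|ground M :&: B'| = #|B|.
  by move=> b'; rewrite (card_bases bB b') (finset.setIidPr (bases_sub_ground b')).
apply/eqP; rewrite eqn_leq; apply/andP; split.
  by apply/bigmax_leqP => B' /cI ->.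
by rewrite -(cI _ bB); apply: (leq_bigmax_cond (P := mem (bases M))).
Qed.

(** Elements of [B0] outside both [I] and [B] are exchanged one by one for elements of [B]; elements
    of [I] are never removed. *)
Lemma basis_augment I B B0 : I \subset B0 -> B0 \in bases M -> B \in bases M ->
  exists B', [/\ B' \in bases M, I \subset B' & B' \subset I :|: B].
Proof.
have [n] := ubnP #|B0 :\: B|; elim: n B0 => // n IH B0 ltn I0 b0 bB.
have [/eqP|[x]] := set_0Vmem (B0 :\: (I :|: B)).
  by rewrite finset.setD_eq0 => ?; exists B0.
rewrite !inE negb_or => /andP[/andP[xI xB] xB0].
have xD : x \in B0 :\: B by rewrite inE xB.
have [y yB b] := bases_exchange b0 bB xD.
apply: (IH (y |: B0 :\ x)) => //.
  have yB' : y \in B by move: yB; rewrite inE => /andP[].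
  exact: leq_trans (exchange_setD_proper xD yB') _.
apply/fintype.subsetP => z zI; rewrite !inE (fintype.subsetP I0 z zI) andbT.
by apply/orP; right; apply: contraNneq xI => <-.
Qed.

Lemma rank_gt0P A : (0 < rank M A)%N ->
  exists2 B, B \in bases M & (0 < #|A :&: B|)%N.
Proof.
move=> rA; apply: contrapT => noB.
suff r0 : rank M A = 0%N by rewrite r0 in rA.
apply: big1 => B bB; apply/eqP; rewrite -leqn0 leqNgt.
by apply/negP => ?; apply: noB; exists B.
Qed.

(* If S+ij and S+kl are bases, exchange gives every vertex of the bipartite
   graph {a, b | S+ab a basis} between {i, j} and {k, l} a neighbour, hence the
   graph has a perfect matching. *)
Lemma bases_three_term (S : {set T}) i j k l :
    i \notin S -> j \notin S -> k \notin S -> l \notin S ->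
    uniq [:: i; j; k; l] ->
  (S :|: [set i; j])%SET \in bases M -> (S :|: [set k; l])%SET \in bases M ->
  ((S :|: [set i; k])%SET \in bases M /\ (S :|: [set j; l])%SET \in bases M) \/
  ((S :|: [set i; l])%SET \in bases M /\ (S :|: [set j; k])%SET \in bases M).
Proof.
have exch a b c d : a \notin S -> b \notin S -> c \notin S -> d \notin S ->
    uniq [:: a; b; c; d] ->
    (S :|: [set a; b])%SET \in bases M -> (S :|: [set c; d])%SET \in bases M ->
    (S :|: [set a; c])%SET \in bases M \/ (S :|: [set a; d])%SET \in bases M.
  move=> aS bS cS dS; rewrite /= !inE !negb_or -!andbA.
  move=> /and5P[ab ac ad bc /and3P[bd cd _]] b1 b2.
  have [|y] := bases_exchange (x := b) b1 b2.
    by rewrite !inE (negPf bS) (negPf bc) (negPf bd) eqxx !orbT.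
  rewrite !inE !negb_or => /andP[/and3P[yS ya yb] yScd].
  have -> : (y |: (S :|: [set a; b]) :\ b = S :|: [set a; y])%SET.
    apply/setP => z; rewrite !inE; have [->|zb] := eqVneq z b.
      by rewrite (negPf bS) ![b == _]eq_sym (negPf ab) (negPf yb).
    by rewrite /= orbF orbC -orbA.
  by move: yScd; rewrite (negPf yS) /= => /orP[] /eqP ->; [left|right].
move=> iS jS kS lS; rewrite /= !inE !negb_or -!andbA.
move=> /and5P[ij ik il jk /and3P[jl kl _]] b1 b2.
have C a b : (S :|: [set a; b] = S :|: [set b; a])%SET.
  by rewrite (finset.setUC [set a]%SET).
have U (a b c d : T) : a != b -> a != c -> a != d -> b != c -> b != d ->
    c != d -> uniq [:: a; b; c; d].
  move=> *; rewrite /= !inE !negb_or -!andbA; apply/and5P; split=> //.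
  exact/and3P.
have hi := exch i j k l iS jS kS lS (U _ _ _ _ ij ik il jk jl kl) b1 b2.
have hj : (S :|: [set j; k])%SET \in bases M \/
    (S :|: [set j; l])%SET \in bases M.
  by apply: (exch j i k l) => //; rewrite 1?C //; apply: U; rewrite // eq_sym.
have hk : (S :|: [set k; i])%SET \in bases M \/
    (S :|: [set k; j])%SET \in bases M.
  by apply: (exch k l i j) => //; apply: U => //; rewrite eq_sym.
have hl : (S :|: [set l; i])%SET \in bases M \/
    (S :|: [set l; j])%SET \in bases M.
  by apply: (exch l k i j) => //; rewrite 1?C //; apply: U; rewrite // eq_sym.
move: hk hl; rewrite !(C k) !(C l); tauto.
Qed.

End MatroidBases.

(** * Three-term relations, their infinite terms, and the zero valuation *)

Section Valuations.
Variables (R : realType) (T : finType) (M : matroid T).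
Implicit Types (w : weights R M) (q : plucker_index M) (t : 'I_3) (A : {set T}).

Lemma wext_basis w (B : basis M) : wext w (val B) = (w B)%:E.
Proof. by rewrite /wext valK. Qed.

Lemma wext_basisE w A (bA : A \in bases M) : wext w A = (w (exist _ A bA))%:E.
Proof. by rewrite -wext_basis. Qed.

Lemma wext_nbasis w A : A \notin bases M -> wext w A = +oo%E.
Proof. by move=> nA; rewrite /wext insubN. Qed.

Lemma wextD_eqy w A A' : (wext w A + wext w A' == +oo)%E =
  ~~ ((A \in bases M) && (A' \in bases M)).
Proof.
case: (boolP (A \in bases M)) => bA; case: (boolP (A' \in bases M)) => bA'.
- by rewrite (wext_basisE w bA) (wext_basisE w bA').
- by rewrite (wext_basisE w bA) (wext_nbasis w bA').
- by rewrite (wext_nbasis w bA) (wext_basisE w bA').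
- by rewrite (wext_nbasis w bA) (wext_nbasis w bA').
Qed.

(** With [pair2], the three splittings of i, j, k, l into two pairs, the one in [pair1] holding i.
    They allow arguments uniform in [t]. *)
Definition pair1 q t : {set T} :=
  [set idx_i q; tnth [tuple idx_j q; idx_k q; idx_l q] t]%SET.
Definition pair2 q t : {set T} :=
  [set tnth [tuple idx_k q; idx_j q; idx_j q] t;
       tnth [tuple idx_l q; idx_l q; idx_k q] t]%SET.

Lemma plucker_termE w q t :
  plucker_term w q t =
    (wext w (idx_S q :|: pair1 q t)%SET + wext w (idx_S q :|: pair2 q t)%SET)%E.
Proof.
by case: t => [[|[|[|//]]] ?];
   rewrite /plucker_term /pair1 /pair2 !(tnth_nth 0%E) !(tnth_nth (idx_i q)).
Qed.

Lemma mem_pairs q t x : (x \in [:: idx_i q; idx_j q; idx_k q; idx_l q]) =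
  (x \in pair1 q t) || (x \in pair2 q t).
Proof.
case: t => [[|[|[|//]]] ?]; rewrite /pair1 /pair2 !(tnth_nth (idx_i q)) /= !inE;
  by do 4 case: (x == _).
Qed.

Lemma pairs_disjoint q t x : x \in pair1 q t -> x \notin pair2 q t.
Proof.
have : [/\ idx_i q != idx_j q, idx_i q != idx_k q, idx_i q != idx_l q,
          idx_j q != idx_k q & idx_j q != idx_l q] /\ idx_k q != idx_l q.
  have := idx_uniq q; rewrite /= !inE !negb_or -!andbA.
  by move=> /and5P[? ? ? ? /and3P[]].
move=> [[ij ik il jk jl] kl].
case: t => [[|[|[|//]]] ?]; rewrite /pair1 /pair2 !(tnth_nth (idx_i q)) /= !inE;
  move=> /orP[] /eqP ->; rewrite negb_or; apply/andP; split;
  by rewrite // eq_sym.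
Qed.

(** Infinity of a term depends only on which sets are bases; the zero weight is the common
    reference. *)
Lemma plucker_term_eqy w w' q t :
  (plucker_term w q t == +oo%E) = (plucker_term w' q t == +oo%E).
Proof.
have h (u : weights R M) : (plucker_term (0 : weights R M) q t == +oo%E) =
           (plucker_term u q t == +oo%E).
  by rewrite (plucker_term0 u); case: (_ u q t == _).
by rewrite -!h.
Qed.

(** All finite terms of a multiple of [ones] are equal, and an infinite term attains the minimum for
    [w] only if all three are infinite. *)
Lemma attains_minZones w q t a : attains_min w q t ->
  attains_min (a *: ones R M) q t.
Proof.
have termE t' : plucker_term (a *: ones R M) q t' =
    if plucker_term w q t' == +oo%E then +oo%E else (a + a)%:E.
  rewrite (plucker_term_eqy w (a *: ones R M)) !plucker_termE /wext.
  by do 2 case: insub => [?|] //=; rewrite !ffunE /= ?[_ *: _]mulr1.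
move=> mt t'; rewrite !termE; have := mt t'.
have [->|_] := eqVneq (plucker_term w q t) +oo%E.
  by rewrite leye_eq => /eqP ->; rewrite eqxx.
by case: eqP => _ _; rewrite ?leey.
Qed.

Lemma plucker_coneDones w w' a : plucker_cone w w' ->
  plucker_cone w (w' + a *: ones R M).
Proof.
by move=> cw; apply: plucker_coneD => // q t; exact: attains_minZones.
Qed.

Lemma valuated_plucker_cone w w' :
  valuated w -> plucker_cone w w' -> valuated w'.
Proof.
by move=> vw cw q; have [t1 [t2 [? /cw ? /cw ?]]] := vw q; exists t1, t2.
Qed.

Lemma idx_neqS q : [/\ idx_i q \notin idx_S q, idx_j q \notin idx_S q,
  idx_k q \notin idx_S q & idx_l q \notin idx_S q].
Proof.
by split; apply/negP => xS;
  match type of xS with is_true (?x \in _) =>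
    have := @idx_mem _ _ q x; rewrite !inE eqxx ?orbT xS => /(_ isT) end.
Qed.

(** Finite terms of the zero weight are all 0, so the claim is that no relation has exactly one
    finite term; this is [bases_three_term]. *)
Lemma valuated0 : valuated (0 : weights R M).
Proof.
move=> q; have [iS jS kS lS] := idx_neqS q.
pose term := plucker_term (0 : weights R M) q.
pose b a c := (idx_S q :|: [set a; c])%SET \in bases M.
have bC a c : b a c = b c a by rewrite /b (finset.setUC [set a]%SET).
have finE t : (term t != +oo%E) =
    tnth [tuple b (idx_i q) (idx_j q) && b (idx_k q) (idx_l q);
                b (idx_i q) (idx_k q) && b (idx_j q) (idx_l q);
                b (idx_i q) (idx_l q) && b (idx_j q) (idx_k q)] t.
  rewrite /term plucker_termE wextD_eqy negbK /pair1 /pair2 /b.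
  by case: t => [[|[|[|//]]] ?];
    rewrite !(tnth_nth (idx_i q)) (tnth_nth true).
have two t : term t != +oo%E -> exists2 t', t != t' & term t' != +oo%E.
  have uq := idx_uniq q.
  (* The exchange lemma starts from the pair i, j; the other two terms are reduced to it by
     permuting the indices. *)
  have uq2 : uniq [:: idx_i q; idx_k q; idx_j q; idx_l q].
    rewrite (perm_uniq (_ : perm_eq _ [:: idx_i q; idx_j q; idx_k q; idx_l q])) //.
    rewrite perm_cons.
    exact: permEl (perm_catCA [:: idx_k q] [:: idx_j q] [:: idx_l q]).
  have uq3 : uniq [:: idx_i q; idx_l q; idx_j q; idx_k q].
    rewrite (perm_uniq (_ : perm_eq _ [:: idx_i q; idx_j q; idx_k q; idx_l q])) //.
    rewrite perm_cons.
    exact: permEl (perm_catC [:: idx_l q] [:: idx_j q; idx_k q]).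
  have wit (m : nat) : (m < 3)%N -> m != t ->
      nth true [:: b (idx_i q) (idx_j q) && b (idx_k q) (idx_l q);
                   b (idx_i q) (idx_k q) && b (idx_j q) (idx_l q);
                   b (idx_i q) (idx_l q) && b (idx_j q) (idx_k q)] m ->
      exists2 t', t != t' & term t' != +oo%E.
    move=> m3 mt bm; exists (Ordinal m3); first by rewrite -val_eqE eq_sym.
    by rewrite finE (tnth_nth true).
  rewrite finE; case: t wit => [[|[|[|//]]] ?] wit;
    rewrite (tnth_nth true) => /= /andP[b1 b2].
  - have [[c1 c2]|[c1 c2]] := bases_three_term iS jS kS lS uq b1 b2.
      by apply: (wit 1) => //=; rewrite /b c1 c2.
    by apply: (wit 2) => //=; rewrite /b c1 c2.
  - have [[c1 c2]|[c1 c2]] := bases_three_term iS kS jS lS uq2 b1 b2.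
      by apply: (wit 0) => //=; rewrite /b c1 c2.
    by apply: (wit 2) => //=; rewrite [b (idx_j q) _]bC /b c1 c2.
  - have [[c1 c2]|[c1 c2]] := bases_three_term iS lS jS kS uq3 b1 b2.
      by apply: (wit 0) => //=; rewrite [b (idx_k q) _]bC /b c1 c2.
    by apply: (wit 1) => //=; rewrite [b (idx_j q) _]bC /b c1 c2.
have min0 t : term t != +oo%E -> attains_min (0 : weights R M) q t.
  move=> ft t'; rewrite (plucker_term0 0) (negPf ft) (plucker_term0 0).
  by case: ifP; rewrite ?leey.
case: (pselect (exists t, term t != +oo%E)) => [[t ft]|nf].
  have [t' tt' ft'] := two t ft.
  by exists t, t'; split => //; exact: min0.
have allmin t : attains_min (0 : weights R M) q t.
  move=> t'; rewrite -/(term t'); case: (eqVneq (term t') +oo%E) => [->|h].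
    exact: leey.
  by case: nf; exists t'.
by exists ord0, ord_max; split.
Qed.

End Valuations.

(** * Bases and parallel elements *)

Section ParallelBases.
Variables (T : finType) (M : matroid T).
Implicit Types (e : T) (B : {set T}).

Lemma parallel_sym e e' : parallel M e e' -> parallel M e' e.
Proof. by case=> re re' ree'; split; rewrite // finset.setUC. Qed.

Lemma parallel_mem_basis e e' : parallel M e e' ->
  exists2 B, B \in bases M & e \in B.
Proof.
case=> re _ _; have [|B bB] := @rank_gt0P _ M [set e]%SET; first by rewrite re.
by case/card_gt0P => x; rewrite !inE => /andP[/eqP -> eB]; exists B.
Qed.

Lemma parallel_not_both e e' B : e != e' -> parallel M e e' ->
  B \in bases M -> e \in B -> e' \notin B.
Proof.
move=> ee' [_ _ ree'] bB eB; apply/negP => e'B.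
have : (#|[set e; e']%SET :&: B| <= rank M [set e; e']%SET)%N.
  exact: (@leq_bigmax_cond _ (mem (bases M))
    (fun B : {set T} => #|[set e; e'] :&: B|)).
have /finset.setIidPl -> : [set e; e']%SET \subset B.
  by apply/fintype.subsetP => x; rewrite !inE => /orP[] /eqP ->.
by rewrite ree' cards2 ee'.
Qed.

(** Augmenting {e} inside [B] gives a basis that contains [e], hence avoids [e'], and lies in [B] +
    [e]; equal cardinality forces it to be [B] - [e'] + [e]. *)
Lemma parallel_swap e e' B : e != e' -> parallel M e e' ->
  B \in bases M -> e' \in B -> (e |: B :\ e')%SET \in bases M.
Proof.
move=> ee' par bB e'B.
have [B0 b0 eB0] := parallel_mem_basis par.
have [|B' [b' eB' B'B]] := basis_augment (I := [set e]%SET) _ b0 bB.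
  by rewrite finset.sub1set.
rewrite finset.sub1set in eB'.
have e'B' := parallel_not_both ee' par b' eB'.
suff <- : B' = (e |: B :\ e')%SET by [].
have eB : e \notin B.
  by apply: contraL e'B; exact: parallel_not_both.
apply/eqP; rewrite eqEcard (card_exchange e'B eB) (card_bases bB b') leqnn andbT.
apply/fintype.subsetP => x xB'; have := fintype.subsetP B'B x xB'; rewrite !inE.
case/orP => [->//|->]; rewrite andbT; apply/orP; right.
by apply: contraNneq e'B' => <-.
Qed.

End ParallelBases.

(** * Sliding [e'] to [e]: bases of the matroid and of the deletion *)

Section Parallel.
Variables (R : realType) (T : finType) (M : matroid T) (e e' : T).
Hypotheses (hne : e != e') (hpar : parallel M e e').
Let N := deletion (parallel_avoidable hne hpar).
Implicit Types (A B S : {set T}) (v : weights R N) (w : weights R M).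
Implicit Types (q : plucker_index M) (t : 'I_3) (c : R).

Lemma mem_deletion_bases B : (B \in bases N) = (B \in bases M) && (e' \notin B).
Proof. by rewrite inE. Qed.

Lemma rank_deletion : rank N (ground N) = rank M (ground M).
Proof.
have [B bB] := bases_neq0 N; rewrite (rank_ground bB).
by move: bB; rewrite mem_deletion_bases => /andP[/rank_ground].
Qed.

Definition slide A : {set T} := if e' \in A then (e |: A :\ e')%SET else A.

(** Both directions are swaps of parallel elements. Sets containing both [e] and [e'] must be
    excluded: such an [A] slides to [A] - [e'], which can be a basis although [A] is not. *)
Lemma slide_bases A : ~~ ((e \in A) && (e' \in A)) ->
  (slide A \in bases N) = (A \in bases M).
Proof.
rewrite mem_deletion_bases /slide; case: ifPn => [e'A|e'A _];
  last by rewrite e'A andbT.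
rewrite andbT => eA; rewrite !inE eqxx orbF eq_sym (negPf hne) andbT.
apply/idP/idP => bA; last exact: parallel_swap.
have e'A' : e \in (e |: A :\ e')%SET by rewrite !inE eqxx.
have := parallel_swap (e := e') (e' := e) _ (parallel_sym hpar) bA e'A'.
rewrite eq_sym => /(_ hne); rewrite setU1K ?finset.setD1K //.
by rewrite !inE negb_and eA orbT.
Qed.

Lemma basis_not_both A : A \in bases M -> ~~ ((e \in A) && (e' \in A)).
Proof.
move=> bA; apply/negP => /andP[eA].
exact/negP/(parallel_not_both hne hpar bA eA).
Qed.

Lemma slide_ground A : A \subset ground M -> slide A \subset ground N.
Proof.
have eM : e \in ground M.
  have [B bB] := parallel_mem_basis hpar.
  exact: (fintype.subsetP (bases_sub_ground bB)).
move=> /fintype.subsetP AM; apply/fintype.subsetP => x /=; rewrite /slide !inE.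
case: ifPn => e'A.
  by rewrite !inE => /orP[/eqP ->|/andP[-> /AM ->]//]; rewrite hne eM.
by move=> xA; rewrite (AM x xA) andbT; apply: contraNneq e'A => <-.
Qed.

Lemma basis_of_deletionP (B : basis N) : val B \in bases M.
Proof. by have := valP B; rewrite mem_deletion_bases => /andP[]. Qed.

Lemma slide_basisP (B : basis M) : slide (val B) \in bases N.
Proof. by rewrite slide_bases ?basis_not_both ?(valP B). Qed.

(** * Restriction to the deletion and extension by a constant *)

Definition restr w : weights R N :=
  [ffun B => w (exist _ (val B) (basis_of_deletionP B))].

(** Pull-back along [slide], a linear section of [restr]: bases that differ by swapping [e] and [e']
    get the same weight. *)
Definition lift_weights v : weights R M :=
  [ffun B => v (exist _ (slide (val B)) (slide_basisP B))].

(** The direction in which the constant c varies; it spans the part of the lineality space that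
    restriction to the deletion kills. *)
Definition ind : weights R M := [ffun B : basis M => (e' \in val B)%:R : R^o].

Lemma restr_is_linear : linear restr.
Proof. by move=> a x y; apply/ffunP => B; rewrite !ffunE. Qed.
HB.instance Definition _ :=
  GRing.isLinear.Build R (weights R M) (weights R N) _ restr restr_is_linear.

Lemma lift_is_linear : linear lift_weights.
Proof. by move=> a x y; apply/ffunP => B; rewrite !ffunE. Qed.
HB.instance Definition _ :=
  GRing.isLinear.Build R (weights R N) (weights R M) _ lift_weights
    lift_is_linear.

Definition extend v c : weights R M := lift_weights v + c *: ind.

Lemma wext_extend v c A : ~~ ((e \in A) && (e' \in A)) ->
  wext (extend v c) A = (wext v (slide A) + (c * (e' \in A)%:R)%:E)%E.
Proof.
move=> nA; case: (boolP (A \in bases M)) => bA; last first.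
  by rewrite wext_nbasis // wext_nbasis // slide_bases.
have bA' : slide A \in bases N by rewrite slide_bases.
rewrite (wext_basisE _ bA) (wext_basisE _ bA') -EFinD !ffunE /=.
by congr (v _ + _)%:E; apply: val_inj.
Qed.

Lemma wext_both w A : e \in A -> e' \in A -> wext w A = +oo%E.
Proof.
move=> eA e'A; apply: wext_nbasis.
by apply: (contraL (@basis_not_both A)); rewrite eA.
Qed.

Lemma wext_restr w A : e' \notin A -> wext (restr w) A = wext w A.
Proof.
move=> e'A; case: (boolP (A \in bases M)) => bA; last first.
  by rewrite !wext_nbasis // mem_deletion_bases negb_and bA.
have bA' : A \in bases N by rewrite mem_deletion_bases bA.
rewrite (wext_basisE _ bA) (wext_basisE _ bA') ffunE; congr (w _)%:E.
exact: val_inj.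
Qed.

Lemma restr_ind : restr ind = 0.
Proof.
apply/ffunP => B; rewrite !ffunE /=; have := valP B.
by rewrite mem_deletion_bases => /andP[_ /negPf ->].
Qed.

Lemma restr_lift v : restr (lift_weights v) = v.
Proof.
apply/ffunP => B; rewrite !ffunE; congr (v _); apply: val_inj => /=.
by have := valP B; rewrite mem_deletion_bases /slide => /andP[_ /negPf ->].
Qed.

Lemma restr_extend v c : restr (extend v c) = v.
Proof. by rewrite linearD linearZ /= restr_ind scaler0 addr0 restr_lift. Qed.

Lemma scale_extend a v c : a *: extend v c = extend (a *: v) (a * c).
Proof. by rewrite /extend linearZ scalerDr scalerA. Qed.

(** * Comparison of the three-term relations of the matroid and of the deletion *)

(** The same indices serve in [M] because the ranks agree, and no set occurring in the relation
    contains [e']. *)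
Lemma deletion_index (p : plucker_index N) : exists q, forall w t,
  plucker_term w q t = plucker_term (restr w) p t.
Proof.
have SM : idx_S p \subset ground M.
  by apply: fintype.subset_trans (idx_S_sub p) _; exact: finset.subsetDl.
have cS : (#|idx_S p| + 2 = rank M (ground M))%N.
  by rewrite idx_S_card rank_deletion.
have mp : {subset [:: idx_i p; idx_j p; idx_k p; idx_l p] <=
    ground M :\: idx_S p}.
  by move=> x /idx_mem; rewrite !inE => /and3P[-> _ ->].
exists (PluckerIndex SM cS (idx_uniq p) mp) => w t.
have e'S : e' \notin idx_S p.
  by apply/negP => /(fintype.subsetP (idx_S_sub p)); rewrite !inE eqxx.
have e'p : e' \notin [:: idx_i p; idx_j p; idx_k p; idx_l p].
  by apply/negP => /idx_mem; rewrite !inE eqxx andbF.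
move: e'p; rewrite (mem_pairs p t) negb_or => /andP[e1 e2].
rewrite !plucker_termE !wext_restr // inE negb_or e'S ?e1 ?e2 //.
Qed.

(** Carries a relation of [M] to one of [N] when sliding acts on its sets as an injective
    relabelling: the identity if [e'] does not occur, the transposition of [e] and [e'] if only [e']
    occurs. *)
Lemma slide_index q (phi : T -> T) : injective phi ->
    (forall A, A \subset (idx_S q :|:
        [set x in [:: idx_i q; idx_j q; idx_k q; idx_l q]])%SET ->
      slide A = [set phi x | x in A]%SET) ->
  exists p : plucker_index N,
    [/\ idx_S p = [set phi x | x in idx_S q]%SET,
      forall t, pair1 p t = [set phi x | x in pair1 q t]%SET
    & forall t, pair2 p t = [set phi x | x in pair2 q t]%SET].
Proof.
move=> phiI slideE.
have SN : [set phi x | x in idx_S q]%SET \subset ground N.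
  by rewrite -slideE ?finset.subsetUl // slide_ground ?idx_S_sub.
have cS : (#|[set phi x | x in idx_S q]%SET| + 2 = rank N (ground N))%N.
  by rewrite card_imset // idx_S_card rank_deletion.
have uN : uniq [:: phi (idx_i q); phi (idx_j q); phi (idx_k q); phi (idx_l q)].
  by rewrite -[uniq _]/(uniq (map phi [:: idx_i q; idx_j q; idx_k q; idx_l q]))
    map_inj_uniq // idx_uniq.
have mN : {subset
    [:: phi (idx_i q); phi (idx_j q); phi (idx_k q); phi (idx_l q)] <=
    ground N :\: [set phi x | x in idx_S q]%SET}.
  move=> y /(mapP (s := [:: idx_i q; idx_j q; idx_k q; idx_l q]) (f := phi)).
  case=> x xq ->; rewrite inE mem_imset //.
  have := idx_mem xq; rewrite inE => /andP[-> xM] /=.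
  rewrite -finset.sub1set -[[set phi x]%SET]imset_set1 -slideE.
    by rewrite slide_ground ?finset.sub1set.
  rewrite finset.sub1set.
  by rewrite inE [X in _ || X]inE xq orbT.
exists (PluckerIndex SN cS uN mN).
by split=> // t; rewrite /pair1 /pair2 imsetU !imset_set1;
  case: t => [[|[|[|//]]] ?]; rewrite !(tnth_nth (idx_i q)).
Qed.

(** Abstracts a, b |-> w(S+ab) for an extended weight and S avoiding [e] and [e']. The last clause
    says that [F e' x - F e x] does not depend on x, written with sums because values may be
    infinite. *)
Definition parallel_pairing (F : T -> T -> \bar R) : Prop :=
  [/\ forall a b, F a b = F b a, F e e' = +oo%E, forall a b, F a b != -oo%E
    & forall x y, x \notin [:: e; e'] -> y \notin [:: e; e'] ->
        (F e x + F e' y = F e y + F e' x)%E].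

Definition three_terms (F : T -> T -> \bar R) (i j k l : T) (t : 'I_3) :=
  tnth [tuple (F i j + F k l)%E; (F i k + F j l)%E; (F i l + F j k)%E] t.

(** The term pairing [e] with [e'] is infinite, and the last clause of [parallel_pairing] equates
    the other two. Which term is which depends only on positions, so [t1] and [t2] are chosen before
    [F]. *)
Lemma three_terms_both (i j k l : T) : uniq [:: i; j; k; l] ->
    e \in [:: i; j; k; l] -> e' \in [:: i; j; k; l] ->
  exists t1 t2 : 'I_3, t1 != t2 /\ forall F, parallel_pairing F ->
    three_terms F i j k l t1 = three_terms F i j k l t2 /\
    forall t, t != t1 -> t != t2 -> three_terms F i j k l t = +oo%E.
Proof.
move=> u ei e'i.
have [[ij ik il jk jl] kl] :
    [/\ i != j, i != k, i != l, j != k & j != l] /\ k != l.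
  by move: u; rewrite /= !inE !negb_or -!andbA => /and5P[? ? ? ? /and3P[]].
have nn x : e != x -> e' != x -> x \notin [:: e; e'].
  by move=> h h'; rewrite !inE negb_or ![x == _]eq_sym h h'.
pose o0 : 'I_3 := @Ordinal 3 0 isT.
pose o1 : 'I_3 := @Ordinal 3 1 isT.
pose o2 : 'I_3 := @Ordinal 3 2 isT.
have sol (t1 t2 t3 : 'I_3) : uniq [:: t1; t2; t3] ->
    (forall F, parallel_pairing F ->
      three_terms F i j k l t1 = three_terms F i j k l t2 /\
      three_terms F i j k l t3 = +oo%E) ->
  exists t1 t2 : 'I_3, t1 != t2 /\ forall F, parallel_pairing F ->
    three_terms F i j k l t1 = three_terms F i j k l t2 /\
    forall t, t != t1 -> t != t2 -> three_terms F i j k l t = +oo%E.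
  move=> ut h; exists t1, t2; split.
    by move: ut; rewrite /= !inE negb_or => /andP[/andP[]].
  move=> F pF; have [h12 h3] := h F pF; split=> // t n1 n2.
  suff -> : t = t3 by [].
  move: t1 t2 t3 t ut n1 n2 {h h12 h3} => [[|[|[|//]]] ?] [[|[|[|//]]] ?];
    by move=> [[|[|[|//]]] ?] [[|[|[|//]]] ?] // _ _ _; apply: val_inj.
(* Twelve positions of [e] and [e'] remain; the third argument of [sol] is the term in which they
   are paired. *)
move: ei e'i; rewrite !inE => /or4P[] /eqP Ee /or4P[] /eqP Ee';
  try (by move: hne; rewrite Ee Ee' eqxx);
  [apply: (sol o1 o2 o0)|apply: (sol o0 o2 o1)|apply: (sol o0 o1 o2)
  |apply: (sol o1 o2 o0)|apply: (sol o0 o1 o2)|apply: (sol o0 o2 o1)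
  |apply: (sol o0 o2 o1)|apply: (sol o0 o1 o2)|apply: (sol o1 o2 o0)
  |apply: (sol o0 o1 o2)|apply: (sol o0 o2 o1)|apply: (sol o1 o2 o0)] => //;
  match goal with
    H : e = ?x, H' : e' = ?y |- _ => clear sol; subst x; subst y
  end;
  move=> F [FC Foo FN FK]; rewrite /three_terms !(tnth_nth 0%E) /=;
  (split; last by rewrite 1?(FC e' e) Foo ?addye ?addey).
all: have Fe x : F x e = F e x by rewrite FC.
all: have Fe' x : F x e' = F e' x by rewrite FC.
all: rewrite ?(Fe, Fe').
all: first [apply: FK|rewrite addeC; apply: FK|rewrite [RHS]addeC; apply: FK
  |rewrite addeC [RHS]addeC; apply: FK].
all: by apply: nn; rewrite // eq_sym.
Qed.

(** The alternatives separate relations in which at most one of [e], [e'] occurs from those in which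
    both do. The index [p], or the pair [t1], [t2], is independent of [v] and [c], so that two
    extended weights can be compared on one relation. *)
Lemma plucker_term_extend q :
  (exists p : plucker_index N, forall v c, exists k, forall t,
      plucker_term (extend v c) q t = (plucker_term v p t + k%:E)%E) \/
  (exists t1 t2, t1 != t2 /\ forall v c,
      plucker_term (extend v c) q t1 = plucker_term (extend v c) q t2 /\
      forall t, t != t1 -> t != t2 -> plucker_term (extend v c) q t = +oo%E).
Proof.
pose Q := (idx_S q :|: [set x in [:: idx_i q; idx_j q; idx_k q; idx_l q]])%SET.
have sub1 t : (idx_S q :|: pair1 q t)%SET \subset Q.
  apply: finset.setUS; apply/fintype.subsetP => x xp.
  by rewrite inE (mem_pairs q t) xp.
have sub2 t : (idx_S q :|: pair2 q t)%SET \subset Q.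
  apply: finset.setUS; apply/fintype.subsetP => x xp.
  by rewrite inE (mem_pairs q t) xp orbT.
have shift (phi : T -> T) : injective phi ->
    (forall A, A \subset Q -> slide A = [set phi x | x in A]%SET) ->
    ~~ ((e \in Q) && (e' \in Q)) ->
  exists p : plucker_index N, forall v c, exists k, forall t,
      plucker_term (extend v c) q t = (plucker_term v p t + k%:E)%E.
  move=> phiI slideE nQ; have [p [pS p1 p2]] := slide_index phiI slideE.
  (* If [e'] is in S, both sets of each term contain it, and the shift is 2c; if it is one of i, j,
     k, l, exactly one set does, and the shift is c. *)
  exists p => v c; exists (c * (e' \in idx_S q)%:R + c * (e' \in Q)%:R) => t.
  have nb A : A \subset Q -> ~~ ((e \in A) && (e' \in A)).
    move=> /fintype.subsetP AQ; apply: contra nQ.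
    by move=> /andP[/AQ -> /AQ ->].
  rewrite !plucker_termE !wext_extend ?nb // !slideE //.
  rewrite pS p1 p2 -!imsetU addeACA -EFinD; congr (_ + _%:E)%E.
  have := mem_pairs q t e'; have := @pairs_disjoint _ _ q t e'.
  move: (pair1 q t) (pair2 q t) => P1 P2.
  rewrite /Q !finset.in_setU [_ \in [set x in _]%SET]inE => dj ->.
  case: (e' \in P1) dj => [/(_ isT)/negPf ->|_];
    by case: (e' \in idx_S q) => /=; rewrite ?orbT ?orbF ?mulr0 ?addr0 ?add0r.
case: (boolP (e' \in Q)) => e'Q; last first.
  left; apply: (shift id) => [x y //|A AQ|]; last by rewrite (negPf e'Q) andbF.
  have e'A : e' \notin A by apply: contra e'Q; exact: (fintype.subsetP AQ).
  by rewrite finset.imset_id /slide (negPf e'A).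
case: (boolP (e \in Q)) => eQ; last first.
  left; apply: (shift (tperm e e')) => [|A AQ|].
  - exact: perm_inj.
  - have eA : e \notin A by apply: contra eQ; exact: (fintype.subsetP AQ).
    apply/setP => x; rewrite -[x in RHS](tpermK e e').
    rewrite mem_imset; last exact: perm_inj.
    rewrite /slide; case: ifPn => e'A; rewrite ?inE;
      case: tpermP => [->|->|/eqP xe /eqP xe'].
    + by rewrite eqxx e'A.
    + by rewrite eqxx /= orbF eq_sym (negPf hne) (negPf eA).
    + by rewrite (negPf xe) xe'.
    + by rewrite (negPf eA) (negPf e'A).
    + by rewrite (negPf eA) (negPf e'A).
    + by [].
  - by rewrite (negPf eQ).
right.
(* If [e] or [e'] lies in S, one of the two sets in each term contains both, so every term is
   infinite. *)
have allinf x y : x \in idx_S q -> y \in Q ->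
    [set x; y]%SET = [set e; e']%SET ->
  exists t1 t2 : 'I_3, t1 != t2 /\ forall v c,
      plucker_term (extend v c) q t1 = plucker_term (extend v c) q t2 /\
      forall t, t != t1 -> t != t2 -> plucker_term (extend v c) q t = +oo%E.
  move=> xS yQ xy.
  suff inf w t : plucker_term w q t = +oo%E.
    by exists ord0, ord_max; split=> // v c; split=> [|t _ _]; rewrite !inf.
  have nb A : A \in bases M -> x \in A -> y \notin A.
    move=> bA xA; apply/negP => yA; have /negP[] := basis_not_both bA.
    rewrite -!finset.sub1set -finset.subUset -xy finset.subUset !finset.sub1set.
    by rewrite xA.
  apply/eqP; rewrite plucker_termE wextD_eqy; apply/negP => /andP[b1 b2].
  have mp := mem_pairs q t y.
  move: (pair1 q t) (pair2 q t) mp b1 b2 => P1 P2 mp b1 b2.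
  have := nb _ b1; have := nb _ b2; rewrite !inE xS /= => /(_ isT) + /(_ isT).
  rewrite !negb_or => /andP[yS y2] /andP[_ y1].
  by move: yQ; rewrite inE (negPf yS) inE mp (negPf y1) (negPf y2).
case: (boolP (e \in idx_S q)) => eS; first exact: (allinf e e').
case: (boolP (e' \in idx_S q)) => e'S.
  by apply: (allinf e' e) => //; rewrite finset.setUC.
have ei : e \in [:: idx_i q; idx_j q; idx_k q; idx_l q].
  by move: eQ; rewrite inE (negPf eS) inE.
have e'i : e' \in [:: idx_i q; idx_j q; idx_k q; idx_l q].
  by move: e'Q; rewrite inE (negPf e'S) inE.
have [t1 [t2 [t12 ht]]] := three_terms_both (idx_uniq q) ei e'i.
exists t1, t2; split=> // v c.
pose F a b := wext (extend v c) (idx_S q :|: [set a; b])%SET.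
apply: (ht F); split.
- by move=> a b; rewrite /F (finset.setUC [set a]%SET).
- by apply: wext_both; rewrite !inE eqxx ?orbT.
- by move=> a b; rewrite /F /wext; case: insub.
move=> x y; rewrite !inE !negb_or => /andP[xe xe'] /andP[ye ye'].
(* The set S+e'z slides to S+ez, so the two values differ by exactly c. *)
have Fe' z : z != e -> z != e' -> F e' z = (F e z + c%:E)%E.
  move=> ze ze'; rewrite /F !wext_extend; last 2 first.
  - by rewrite !inE (negPf e'S) ![e' == _]eq_sym (negPf hne) (negPf ze') andbF.
  - by rewrite !inE (negPf eS) ![e == _]eq_sym eq_sym (negPf hne) (negPf ze).
  rewrite /slide !inE (negPf e'S) eqxx [e' == e]eq_sym [e' == z]eq_sym.
  rewrite (negPf hne) (negPf ze') /= mulr1 mulr0 adde0.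
  congr (wext _ _ + _)%E; apply/setP => a; rewrite !inE.
  have [->|ae'] := eqVneq a e'; last by rewrite /= orbCA.
  rewrite (negPf e'S) [e' == e]eq_sym [e' == z]eq_sym.
  by rewrite (negPf hne) (negPf ze').
by rewrite !Fe' // addeCA.
Qed.

(** * Cones and valuations as pairs of a restriction and a constant *)

(** Relations of [N] are relations of [M] on restrictions; conversely, relations of [M] are shifts
    of relations of [N] or impose nothing on extended weights. *)
Lemma plucker_cone_extend v v' c c' :
  plucker_cone (extend v c) (extend v' c') <-> plucker_cone v v'.
Proof.
split=> [h p t|h q t].
  have [q qE] := deletion_index p.
  have := h q t; rewrite /attains_min => {}h hp t'.
  rewrite -(restr_extend v' c') -!qE; apply: h => t''.
  by rewrite !qE restr_extend.
have [[p pE]|[t1 [t2 [t12 tE]]]] := plucker_term_extend q.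
  have [k kE] := pE v c; have [k' kE'] := pE v' c' => ht t'.
  rewrite !kE' leeD2rE //; apply: h => t''.
  by have := ht t''; rewrite !kE leeD2rE.
(* Here [t1] and [t2] always attain the minimum. The third term attains it only if all three are
   infinite, which does not depend on the weights. *)
have [E12 Einf] := tE v c; have [E12' Einf'] := tE v' c' => ht t'.
have := ht t1; have := plucker_term_eqy (extend v c) (extend v' c') q.
have min1 : attains_min (extend v' c') q t1.
  move=> s; have [->//|s1] := eqVneq s t1; have [->|s2] := eqVneq s t2.
    by rewrite E12'.
  by rewrite (Einf' s) // leey.
move=> eqy; have [->|n1] := eqVneq t t1; first by move=> _; exact: min1.
have [->|n2] := eqVneq t t2; first by move=> _; rewrite -E12'; exact: min1.
rewrite (Einf t) // leye_eq eqy => /eqP y1.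
by have := min1 t'; rewrite y1 leye_eq => /eqP ->; rewrite leey.
Qed.

Lemma valuated_extend v c : valuated v -> valuated (extend v c).
Proof.
move=> vv q; have [[p pE]|[t1 [t2 [t12 tE]]]] := plucker_term_extend q.
  have [k kE] := pE v c; have [t1 [t2 [t12 m1 m2]]] := vv p.
  by exists t1, t2; split=> // t'; rewrite !kE leeD2rE.
have [E12 Einf] := tE v c.
have min1 : attains_min (extend v c) q t1.
  move=> s; have [->//|s1] := eqVneq s t1; have [->|s2] := eqVneq s t2.
    by rewrite E12.
  by rewrite (Einf s) // leey.
by exists t1, t2; split=> // s; rewrite -E12.
Qed.

Lemma valuated_restr w : valuated w -> valuated (restr w).
Proof.
move=> vw p; have [q qE] := deletion_index p.
have [t1 [t2 [t12 m1 m2]]] := vw q.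
by exists t1, t2; split=> // t'; rewrite -!qE.
Qed.

(* The relation at i, j = e, e' has an infinite term, so it is an equality. *)
Lemma valuated_exchange w B x y : valuated w -> B \in bases M -> e' \in B ->
    x \in B -> x != e' -> y \notin B -> (y |: B :\ x)%SET \in bases M ->
  (wext w (slide B) + wext w (y |: B :\ x)%SET =
   wext w (slide (y |: B :\ x)%SET) + wext w B)%E.
Proof.
move=> vw bB e'B xB xe' yB bB'.
have e'B' : e' \in (y |: B :\ x)%SET.
  by rewrite !inE e'B [e' == x]eq_sym xe' orbT.
have eB : e \notin B by have := basis_not_both bB; rewrite e'B andbT.
have eB' : e \notin (y |: B :\ x)%SET.
  by have := basis_not_both bB'; rewrite e'B' andbT.
have neqB a b : a \in B -> b \notin B -> a != b.
  by move=> aB; apply: contraNneq => <-.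
(* With S = B - e' - x, the relation at e, e', x, y has S+ex = [slide B], S+e'y = B - x + y, S+ey
   the slide of the latter, and S+e'x = B. *)
have ey : e != y by apply: contraNneq eB' => ->; rewrite !inE eqxx.
pose S := (B :\ e' :\ x)%SET.
have [bM bM'] := (bases_sub_ground bB, bases_sub_ground bB').
have SM : S \subset ground M.
  apply: fintype.subset_trans bM; apply/fintype.subsetP => z.
  by rewrite !inE => /and3P[].
have cS : (#|S| + 2 = rank M (ground M))%N.
  rewrite (rank_ground bB) (cardsD1 e' B) e'B (cardsD1 x (B :\ e')) !inE xe' xB.
  by rewrite addnC.
have uS : uniq [:: e; e'; x; y].
  rewrite /= !inE !negb_or hne ey ![e == x]eq_sym ![e' == x]eq_sym xe' !neqB //.
have mS : {subset [:: e; e'; x; y] <= ground M :\: S}.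
  have /slide_ground/fintype.subsetP sN := bM.
  have eM : e \in ground M.
    have : e \in slide B by rewrite /slide e'B !inE eqxx.
    by move=> /sN; rewrite !inE => /andP[].
  move=> z; rewrite !inE => /or4P[] /eqP ->.
  - by rewrite eM (negPf eB) !andbF.
  - by rewrite eqxx andbF (fintype.subsetP bM).
  - by rewrite eqxx (fintype.subsetP bM).
  - by rewrite (negPf yB) !andbF (fintype.subsetP bM') // !inE eqxx.
pose q := PluckerIndex SM cS uS mS.
have q0 : plucker_term w q (@Ordinal 3 0 isT) = +oo%E.
  apply/eqP; rewrite plucker_termE wextD_eqy; apply/negP => /andP[b1 _].
  have := basis_not_both b1; rewrite /pair1 /= !(tnth_nth e) /= !inE !eqxx.
  by rewrite !orbT.
have q1 : plucker_term w q (@Ordinal 3 1 isT) =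
    (wext w (slide B) + wext w (y |: B :\ x)%SET)%E.
  rewrite plucker_termE /pair1 /pair2 !(tnth_nth e) /=.
  congr (wext w _ + wext w _)%E.
    rewrite /slide e'B; apply/setP => z; rewrite !inE.
    have [->|zx] := eqVneq z x; first by rewrite xe' xB !orbT.
    by rewrite orbF orbC.
  apply/setP => z; rewrite !inE; have [->|ze'] := eqVneq z e'.
    by rewrite e'B [e' == x]eq_sym xe' !orbT.
  by rewrite orbC.
have q2 : plucker_term w q (@Ordinal 3 2 isT) =
    (wext w (slide (y |: B :\ x)%SET) + wext w B)%E.
  rewrite plucker_termE /pair1 /pair2 !(tnth_nth e) /=.
  congr (wext w _ + wext w _)%E.
    rewrite /slide e'B'; apply/setP => z; rewrite !inE.
    have [->|zx] := eqVneq z e'.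
      by rewrite !andbF [e' == e]eq_sym (negPf hne) (negPf (neqB _ _ e'B yB)).
    by rewrite /= orbC -orbA [(z == y) || _]orbC.
  apply/setP => z; rewrite !inE; have [->|ze'] := eqVneq z e'.
    by rewrite e'B !orbT.
  by have [->|zx] := eqVneq z x; rewrite ?xB ?orbT ?orbF.
have f1 : plucker_term w q (@Ordinal 3 1 isT) != +oo%E.
  rewrite q1 wextD_eqy negbK bB' andbT.
  have : slide B \in bases N by rewrite slide_bases ?basis_not_both.
  by rewrite mem_deletion_bases => /andP[].
have [t1 [t2 [t12 m1 m2]]] := vw q.
have fin t : attains_min w q t -> t != @Ordinal 3 0 isT.
  move=> mt; apply: contra f1 => /eqP t0; have := mt (@Ordinal 3 1 isT).
  by rewrite t0 q0 leye_eq.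
rewrite -q1 -q2.
have [n1 n2] := (fin _ m1, fin _ m2).
have ge : plucker_term w q t1 = plucker_term w q t2.
  by apply: le_anti; rewrite m1 m2.
case: t1 t2 t12 n1 n2 ge {m1 m2} => [[|[|[|//]]] h1] [[|[|[|//]]] h2] //= _ _ _;
  rewrite (bool_irrelevance h1 isT) (bool_irrelevance h2 isT) // => ->.
Qed.

(** The difference w(B) - w([slide B]) is the same for all bases containing [e']: any two are joined
    by exchanges that keep [e'], and each exchange preserves it by [valuated_exchange]. *)
Lemma valuated_extend_restr w : valuated w -> exists c, w = extend (restr w) c.
Proof.
move=> vw; pose r A := fine (wext w A).
have rE A : A \in bases M -> wext w A = (r A)%:E.
  by move=> bA; rewrite /r (wext_basisE w bA).
have slideM A : A \in bases M -> slide A \in bases M.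
  move=> bA; have : slide A \in bases N by rewrite slide_bases ?basis_not_both.
  by rewrite mem_deletion_bases => /andP[].
have const B1 B2 : B1 \in bases M -> B2 \in bases M -> e' \in B1 -> e' \in B2 ->
    r B1 - r (slide B1) = r B2 - r (slide B2).
  have [n] := ubnP #|B1 :\: B2|; elim: n B1 => // n IH B1 ltn b1 b2 e1 e2.
  have [/eqP|[x xB]] := set_0Vmem (B1 :\: B2).
    rewrite finset.setD_eq0 => B12; suff -> : B1 = B2 by [].
    by apply/eqP; rewrite eqEcard B12 (card_bases b2 b1) leqnn.
  have [y yB b] := bases_exchange b1 b2 xB.
  move: (xB) (yB); rewrite !inE => /andP[xB2 xB1] /andP[yB1 yB2].
  (* The removed element is outside [B2], which contains [e']; hence the exchange keeps [e']. *)
  have xe' : x != e' by apply: contraNneq xB2 => ->.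
  rewrite -(IH (y |: B1 :\ x)%SET) //; last 2 first.
  - exact: leq_trans (exchange_setD_proper xB yB2) _.
  - by rewrite !inE e1 [e' == x]eq_sym xe' orbT.
  have := valuated_exchange vw b1 e1 xB1 xe' yB1 b.
  rewrite !rE ?slideM // -!EFinD => -[E]; apply/eqP.
  by rewrite subr_eq addrAC eq_sym subr_eq addrC E addrC.
(* Since [e'] is not a loop, some basis contains it, and the constant is read off there. *)
have [B0 b0 e0] := parallel_mem_basis (parallel_sym hpar).
exists (r B0 - r (slide B0)); apply/ffunP => B.
have e'sl : e' \notin slide (val B).
  by have := slide_basisP B; rewrite mem_deletion_bases => /andP[].
have bB := valP B.
apply: EFin_inj; rewrite -!wext_basis wext_extend ?basis_not_both //.
rewrite wext_restr // !rE ?slideM // -EFinD; congr EFin.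
case: (boolP (e' \in val B)) => e'B; last first.
  by rewrite mulr0 addr0 /slide (negPf e'B).
by rewrite mulr1 -(const (val B)) // addrC subrK.
Qed.

End Parallel.

(** * Kernel, image and dimension for quotient projections *)

Section QuotientProjection.
Variables (K : fieldType) (V : vectType K) (U : {vspace V}).

Lemma quot_pi_eq0 x : (quot_pi U x == 0) = (x \in U).
Proof. by rewrite -memv_ker lker_quot_pi. Qed.

Lemma limg_quot_pi : limg (quot_pi U) = fullv.
Proof.
apply/vspaceP => x; rewrite memvf; apply/memv_imgP.
by have [v <-] := quot_pi_surj x; exists v; rewrite ?memvf.
Qed.

Lemma dim_preim_quot_pi (W : {vspace quotv U}) :
  \dim (quot_pi U @^-1: W) = (\dim W + \dim U)%N.
Proof.
rewrite -(limg_ker_dim (quot_pi U)) lpreimK ?limg_quot_pi ?subvf // addnC.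
congr (_ + \dim _)%N; rewrite lker_quot_pi; apply/capv_idPr.
apply/subvP => x; rewrite -memv_preim -quot_pi_eq0 => /eqP ->.
exact: mem0v.
Qed.

End QuotientProjection.

(** * The lineality space lifted to weights *)

Section Lineality.
Variables (R : realType) (T : finType) (M : matroid T).
Implicit Types w x : weights R M.

(** Lifting the lineality space along the quotient by [ones] lets the comparison of [M] and [N] take
    place on weights. *)
Definition lin_preim : {vspace weights R M} :=
  (quot_pi <[ones R M]> @^-1: dr_lin R M)%VS.

(** Cones are stable under adding multiples of [ones], so membership modulo [ones] lifts to weights.
    Conversely the line of the image of [x] lies in every cone, and the lineality space is
    maximal. *)
Lemma lin_preimP x :
  reflect (forall w, valuated w -> forall a, plucker_cone w (a *: x))
          (x \in lin_preim).
Proof.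
rewrite -memv_preim; have [linC linmax] := dr_linP R M.
apply: (iffP idP) => [xL w vw a|h].
  have FC : dr_fan R M (quot_pi <[ones R M]>%VS @` plucker_cone w)%classic.
    by exists w.
  have [|w' cw'] := linC _ FC (quot_pi <[ones R M]>%VS (a *: x)).
    by rewrite /= linearZ memvZ.
  move=> /eqP; rewrite eq_sym -subr_eq0 -linearB quot_pi_eq0 => /vlineP[b xb].
  by rewrite -(subrK w' (a *: x)) addrC xb; exact: plucker_coneDones.
rewrite -[_ \in _]/(_ <= _)%VS; apply: linmax => _ [w vw <-] y /= /vlineP[a ->].
by exists (a *: x); rewrite ?linearZ //; exact: h.
Qed.

Lemma ones_neq0 : ones R M != 0.
Proof.
have [B bB] := bases_neq0 M; apply/eqP => /ffunP/(_ (exist _ B bB)).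
by rewrite !ffunE => /eqP; rewrite oner_eq0.
Qed.

Lemma dim_lin_preim : \dim lin_preim = (\dim (dr_lin R M) + 1)%N.
Proof. by rewrite dim_preim_quot_pi dim_vline ones_neq0. Qed.

(** Both quotients as one surjection with kernel [lin_preim]. *)
Definition quot_lin : 'Hom(weights R M, quotv (dr_lin R M)) :=
  (quot_pi (dr_lin R M) \o quot_pi <[ones R M]>%VS)%VF.

Lemma quot_linE w :
  quot_lin w = quot_pi (dr_lin R M) (quot_pi <[ones R M]>%VS w).
Proof. by rewrite comp_lfunE. Qed.

Lemma quot_lin_eq x y : (quot_lin x == quot_lin y) = (x - y \in lin_preim).
Proof.
by rewrite -subr_eq0 !quot_linE -linearB quot_pi_eq0 -linearB memv_preim.
Qed.

Lemma quot_linVK : cancel (quot_lin^-1)%VF quot_lin.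
Proof.
move=> y; apply: limg_lfunVK; have [z <-] := quot_pi_surj y.
by have [w <-] := quot_pi_surj z; rewrite -quot_linE memv_img ?memvf.
Qed.

Lemma dr_mod_linE :
  dr_mod_lin R M = [set quot_lin w | w in [set w | valuated w]]%classic.
Proof.
apply/seteqP; split=> [_ [_ [w vw <-] <-]|_ [w vw <-]].
  by exists w; rewrite ?quot_linE.
by exists (quot_pi <[ones R M]>%VS w); [exists w|rewrite quot_linE].
Qed.

Lemma dr_fan_mod_linE : dr_fan_mod_lin R M =
  [set quot_lin @` plucker_cone w | w in [set w | valuated w]]%classic.
Proof.
have E w :
    (quot_pi (dr_lin R M) @` (quot_pi <[ones R M]>%VS @` plucker_cone w) =
            quot_lin @` plucker_cone w)%classic.
  rewrite image_comp; congr (_ @` _)%classic.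
  by apply/funext => x; rewrite /= quot_linE.
apply/seteqP; split=> [_ [_ [w vw <-] <-]|_ [w vw <-]].
  by exists w; rewrite ?E.
exists (quot_pi <[ones R M]>%VS @` plucker_cone w)%classic; last by rewrite E.
by exists w.
Qed.

End Lineality.

(** * The induced isomorphism and the dimension count *)

Section ParallelDressian.
Variables (R : realType) (T : finType) (M : matroid T) (e e' : T).
Hypotheses (hne : e != e') (hpar : parallel M e e').
Let N := deletion (parallel_avoidable hne hpar).
Let rho := linfun (@restr R T M e e' hne hpar).
Local Notation ext := (@extend R T M e e' hne hpar).
Local Notation lift := (@lift_weights R T M e e' hne hpar).
Local Notation ind := (@ind R T M e').

(** Valuations of [M] are exactly the extensions of valuations of [N], and cone membership ignores
    the constants. *)
Lemma mem_lin_preim_extend (v : weights R N) c :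
  (ext v c \in lin_preim R M) = (v \in lin_preim R N).
Proof.
apply/lin_preimP/lin_preimP => h w vw a.
  have := h _ (valuated_extend 0 vw) a.
  by rewrite scale_extend plucker_cone_extend.
have [b ->] := valuated_extend_restr hne hpar vw.
by rewrite scale_extend plucker_cone_extend; apply/h/valuated_restr.
Qed.

(** A lineality vector lies in the cone of the zero valuation, so it is itself a valuation and
    splits. *)
Lemma lin_preim_extend (x : weights R M) : x \in lin_preim R M ->
  exists c, x = ext (rho x) c.
Proof.
move=> /lin_preimP/(_ _ (@valuated0 R T M) 1); rewrite scale1r => cx.
rewrite lfunE; apply: valuated_extend_restr.
exact: valuated_plucker_cone (@valuated0 R T M) cx.
Qed.

Lemma restr_lin_preim (x : weights R M) : x \in lin_preim R M ->
  rho x \in lin_preim R N.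
Proof.
move=> xL; have [c xE] := lin_preim_extend xL.
by rewrite -(mem_lin_preim_extend _ c) -xE.
Qed.

Lemma ind_neq0 : ind != 0.
Proof.
have [B bB e'B] := parallel_mem_basis (parallel_sym hpar).
apply/eqP => /ffunP/(_ (exist _ B bB)).
by rewrite !ffunE /= e'B => /eqP; rewrite oner_eq0.
Qed.

(** Rank-nullity for restriction on [lin_preim R M]: the image is [lin_preim R N] and the kernel is
    the line of [ind]. *)
Lemma dim_lin_preim_parallel :
  \dim (lin_preim R M) = (\dim (lin_preim R N) + 1)%N.
Proof.
rewrite -(limg_ker_dim rho) addnC; congr (\dim _ + _)%N.
  apply/vspaceP => v; apply/memv_imgP/idP => [[x xL ->]|vL].
    exact: restr_lin_preim.
  by exists (ext v 0); rewrite ?mem_lin_preim_extend // lfunE /= restr_extend.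
have -> : (lin_preim R M :&: lker rho = <[ind]>)%VS.
  apply/vspaceP => x; rewrite memv_cap memv_ker.
  apply/andP/vlineP => [[xL /eqP x0]|[c ->]].
    have [c ->] := lin_preim_extend xL; exists c.
    by rewrite x0 /extend linear0 add0r.
  have -> : c *: ind = ext 0 c by rewrite /extend linear0 add0r.
  by rewrite mem_lin_preim_extend mem0v lfunE /= restr_extend.
by rewrite dim_vline ind_neq0.
Qed.

(** Restriction descended to the quotients through a chosen right inverse; the choice is immaterial
    because restriction maps lineality into lineality. *)
Definition quot_restr : 'Hom(quotv (dr_lin R M), quotv (dr_lin R N)) :=
  (quot_lin R N \o rho \o (quot_lin R M)^-1)%VF.

Lemma quot_restrE (w : weights R M) :
  quot_restr (quot_lin R M w) = quot_lin R N (rho w).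
Proof.
rewrite /quot_restr 2!comp_lfunE; apply/eqP; rewrite quot_lin_eq -linearB.
by apply: restr_lin_preim; rewrite -quot_lin_eq quot_linVK.
Qed.

(** Modulo lineality a valuation is the lift of its restriction, so the image of [lift] is a
    subspace containing the Dressian, hence its span. Injectivity is tested on such lifts. *)
Lemma span_dr_mod_lin y : in_span (dr_mod_lin R M) y ->
  exists v, y = quot_lin R M (lift v).
Proof.
move=> /(_ (limg (quot_lin R M \o linfun (lift)))%VF) h.
have /memv_imgP[v _ ->] : y \in limg (quot_lin R M \o linfun (lift))%VF.
  apply: h; rewrite dr_mod_linE => _ [w vw <-] /=.
  have [c wE] := valuated_extend_restr hne hpar vw.
  apply/memv_imgP; exists (rho w); rewrite ?memvf // [RHS]comp_lfunE.
  apply/eqP; rewrite quot_lin_eq !lfunE /=.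
  set v := restr _ _ w; rewrite wE.
  have -> : ext v c - lift v = ext 0 c.
    by rewrite /extend linear0 add0r addrAC subrr add0r.
  by rewrite mem_lin_preim_extend mem0v.
by exists v; rewrite [LHS]comp_lfunE [linfun _ v]lfunE.
Qed.

Lemma fan_isomorphic_deletion :
  fan_isomorphic (dr_mod_lin R M) (dr_fan_mod_lin R M)
                 (dr_mod_lin R N) (dr_fan_mod_lin R N).
Proof.
have rhoE v c : rho (ext v c) = v by rewrite lfunE /= restr_extend.
exists quot_restr; split.
- move=> x y /span_dr_mod_lin[v ->] /span_dr_mod_lin[v' ->].
  rewrite !quot_restrE => /eqP; rewrite quot_lin_eq => vL.
  have {}vL : v - v' \in lin_preim R N.
    by move: vL; rewrite !lfunE /= !restr_lift.
  apply/eqP; rewrite quot_lin_eq.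
  have -> : lift v - lift v' = ext (v - v') 0.
    by rewrite /extend scale0r addr0 linearB.
  by rewrite mem_lin_preim_extend.
- rewrite !dr_mod_linE; apply/seteqP; split=> [_ [_ [w vw <-] <-]|_ [v vv <-]].
    by exists (rho w); rewrite ?quot_restrE //= lfunE; exact: valuated_restr.
  exists (quot_lin R M (ext v 0)); last by rewrite quot_restrE rhoE.
  by exists (ext v 0) => //; exact: valuated_extend.
(* Every element of a cone of a valuation is a valuation, hence an extension; [plucker_cone_extend]
   then matches the cones. *)
have coneE w : valuated w -> (quot_restr @` (quot_lin R M @` plucker_cone w) =
    quot_lin R N @` plucker_cone (rho w))%classic.
  move=> vw; have [c wE] := valuated_extend_restr hne hpar vw.
  apply/seteqP; split=> [_ [_ [w' cw' <-] <-]|_ [v cv <-]].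
    have vw' := valuated_plucker_cone vw cw'.
    have [c' wE'] := valuated_extend_restr hne hpar vw'.
    exists (rho w'); last by rewrite quot_restrE.
    by move: cw'; rewrite wE wE' plucker_cone_extend !rhoE.
  exists (quot_lin R M (ext v 0)); last by rewrite quot_restrE rhoE.
  exists (ext v 0) => //.
  by rewrite wE plucker_cone_extend -(rhoE (restr _ _ w) c) -wE.
rewrite !dr_fan_mod_linE; apply/seteqP.
split=> [_ [_ [w vw <-] <-]|_ [v vv <-]].
  by exists (rho w); rewrite ?coneE //= lfunE; exact: valuated_restr.
have vw := valuated_extend (hne := hne) (hpar := hpar) 0 vv.
exists (quot_lin R M @` plucker_cone (ext v 0))%classic.
  by exists (ext v 0).
by rewrite coneE ?rhoE.
Qed.

End ParallelDressian.

Theorem mainTheorem9 (R : realType) (T : finType) (M : matroid T) (e e' : T)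
    (hne : e != e') (hpar : parallel M e e') :
  let N := deletion (parallel_avoidable hne hpar) in
  fan_isomorphic (dr_mod_lin R M) (dr_fan_mod_lin R M)
                 (dr_mod_lin R N) (dr_fan_mod_lin R N)
  /\ \dim (dr_lin R M) = (\dim (dr_lin R N) + 1)%N.
Proof.
split; first exact: fan_isomorphic_deletion.
(* The added 1 is the line of [ones], present in both lifted lineality spaces. *)
apply/eqP; rewrite -(eqn_add2r 1) -!dim_lin_preim; apply/eqP.
exact: dim_lin_preim_parallel.
Qed.
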